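(* Let $(r_j)_{j\ge1}$ and $(n_j)_{j\ge1}$ be sequences of integers with $1\le r_j<n_j-1$ for all $j$, such that $\lim_{j\to\infty} r_j=\infty$ and $\lim_{j\to\infty}\frac{r_j}{n_j}=0$. Then the limit points of the zeros of the polynomials (in $z$) $$\left\{ B_{r_j,n_j}\!\left(\frac{r_j z}{n_j-r_j}\right)\right\}_{j=1}^\infty$$ are precisely the points of the Szegő curve $\{z\in\mathbb{C} : |ze^{1-z}|=1,\ |z|\le1\}$.
   Context: For integers $1\le r\le n$, $B_{r,n}(z)=\sum_{k=0}^r\binom{n}{k}z^k$, $z\in\mathbb{C}$. A point $\zeta\in\mathbb{C}$ is a limit point of the zeros of a sequence of polynomials $\{p_j\}$ if there are indices $j_1<j_2<\cdots$ and zeros $z_i$ of $p_{j_i}$ with $z_i\to\zeta$. *)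

(* Defs.v *)
From HB Require Import structures.
From mathcomp Require Import all_boot all_order all_algebra.
From mathcomp Require Import complex.
From mathcomp Require Import all_classical all_reals all_analysis.

Set Implicit Arguments.
Unset Strict Implicit.
Unset Printing Implicit Defensive.

Import Order.TTheory GRing.Theory Num.Theory numFieldNormedType.Exports.

Local Open Scope classical_set_scope.
Local Open Scope complex_scope.
Local Open Scope ring_scope.

Definition binomial_section (K : nzRingType) (r n : nat) : {poly K} :=
  \sum_(k < r.+1) 'C(n, k)%:R *: 'X^k.
Arguments binomial_section : clear implicits.

(* Over an abstract K the convergence is in the norm topology of K.  The type
   R[i] itself carries no topology: at K = R[i] this is that of R[i]^o. *)
Definition zeros_limit_point (K : numFieldType) (p : nat -> {poly K})
    (zeta : K) : Prop :=
  exists (j : nat -> nat) (z : nat -> K),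
    [/\ {homo j : a b / (a < b)%N},
        forall i, root (p (j i)) (z i)
      & z @ \oo --> zeta].

(* e^(x + iy) = e^x (cos y + i sin y) *)
Definition cexp (R : realType) (z : R[i]) : R[i] :=
  let: x +i* y := z in (expR x * cos y) +i* (expR x * sin y).

Definition szego_curve (R : realType) : set R[i] :=
  [set z | `|z * cexp (1 - z)| = 1 /\ `|z| <= 1].
Arguments szego_curve : clear implicits.

(* Main.v *)
Require Import Defs.
From HB Require Import structures.
From mathcomp Require Import all_boot all_order all_algebra.
From mathcomp Require Import complex.
From mathcomp Require Import all_classical all_reals all_analysis.
From mathcomp Require Import ring lra.

(** Put s = r/(n-r), a = C(n,r) s^r, and let p be the rescaled section, so that
    p = (1 + sX)^n - a X^r T with T = sum_(m >= 1) b_m X^m and b_m >= 0.  The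
    coefficients of p increase, so by Enestrom-Kakeya its zeros lie in the closed
    unit disc.  The differential equation
    r(1-X)T = rX - X(1+sX)T', differentiated once and used with the positivity
    of the b_m, gives T(z) -> z/(1-z) uniformly on |z| <= 1 away from 1.  On the
    other hand |a z^r/(1+sz)^n|^(1/r) -> g(z) = |z e^(1-z)|.  At a zero of p the
    quantities a z^r T and (1+sz)^n agree, which forces g = 1 in the limit.

    Conversely, if p has no zero near a point zeta of the curve, 0 < |zeta| < 1,
    then q = p'/(rp), an average of r terms 1/(z - z_i), is Lipschitz near zeta
    uniformly in r.  But (1+sX)p' = r(1+s)p - r a X^r shows that q -> 1 where
    g < 1 and q -> 1/z where g > 1, and both regions accumulate at zeta, where
    1 <> 1/zeta.  The remaining point 1 is a limit of points of the curve. *)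

Set Implicit Arguments.
Unset Strict Implicit.
Unset Printing Implicit Defensive.

Import Order.TTheory GRing.Theory Num.Theory numFieldNormedType.Exports.

Local Open Scope classical_set_scope.
Local Open Scope complex_scope.
Local Open Scope ring_scope.

Lemma ler_norm_horner1 (K : numDomainType) (p : {poly K}) (z : K) :
  p \is a polyOver Num.nneg -> `|z| <= 1 -> `|p.[z]| <= p.[1].
Proof.
move=> /polyOverP p_nneg z1; rewrite !horner_coef.
have p0 i : 0 <= p`_i by exact: p_nneg.
apply: (le_trans (ler_norm_sum _ _ _)); apply: ler_sum => i _.
rewrite expr1n mulr1 normrM normrX ger0_norm ?p0 //.
by rewrite ler_piMr // exprn_ile1.
Qed.

(** * The rescaled section and its tail: coefficients, differential equations, bounds *)

Section Scaled.
Variables (K : numFieldType) (r n : nat).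
Hypotheses (r_gt0 : (0 < r)%N) (r_lt_n : (r < n)%N).

Let s : K := r%:R / (n%:R - r%:R).
Definition scaled_coef k : K := 'C(n, k)%:R * (r%:R / (n%:R - r%:R)) ^+ k.
Local Notation a := scaled_coef.

(** Spelled as in the theorem, so that roots pass from one to the other by conversion. *)
Definition scaled_section : {poly K} :=
  binomial_section K r n \Po ((r%:R / (n%:R - r%:R)) *: 'X).
Local Notation p := scaled_section.

(** The terms of degree above [r] in [(1 + sX)^n], divided by [a r * X^r]. The constant coefficient
    is [0] because the term of degree [r] belongs to the section. *)
Definition scaled_tail : {poly K} :=
  \poly_(m < (n - r).+1) (if m == 0%N then 0 else a (r + m) / a r).
Local Notation T := scaled_tail.

Let nr_gt0 : 0 < n%:R - r%:R :> K.
Proof. by rewrite subr_gt0 ltr_nat. Qed.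

Let s_gt0 : 0 < s.
Proof. by rewrite divr_gt0 ?ltr0n. Qed.

Let snr : s * (n%:R - r%:R) = r%:R.
Proof. by rewrite divfK ?gt_eqF. Qed.

Let nsE : n%:R * s = r%:R * (1 + s).
Proof.
have: s * n%:R = s * r%:R + r%:R by rewrite -[X in _ = _ + X]snr; ring.
by move=> h; rewrite mulrC h; ring.
Qed.

Lemma scaled_coef_ge0 k : 0 <= a k.
Proof. by rewrite mulr_ge0 ?ler0n ?exprn_ge0 // ltW. Qed.

Lemma scaled_coef_gt0 k : (k <= n)%N -> 0 < a k.
Proof. by move=> kn; rewrite mulr_gt0 ?ltr0n ?bin_gt0 ?exprn_gt0. Qed.

Lemma scaled_coefS k : k.+1%:R * a k.+1 = (n%:R - k%:R) * s * a k.
Proof.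
have [kn|nk] := leqP k n; last first.
  by rewrite /a !bin_small ?mul0r ?mulr0 // ltnS ltnW.
rewrite /a -/s -natrB // exprS !mulrA -natrM mul_bin_left natrM.
ring.
Qed.

(** For [l < r] the choice of [s] gives [(l+1) a_(l+1) = (n-l) s a_l >= (n-r) s a_l = r a_l >= (l+1)
    a_l]. *)
Lemma scaled_coef_homo k l : (k <= l <= r)%N -> a k <= a l.
Proof.
move=> /andP[]; elim: l => [|l IH]; first by rewrite leqn0 => /eqP ->.
rewrite leq_eqVlt => /predU1P[-> //|]; rewrite ltnS => kl lr.
apply: (le_trans (IH kl (ltnW lr))).
rewrite -(ler_pM2l (ltr0Sn K l)) scaled_coefS.
rewrite ler_wpM2r ?scaled_coef_ge0 //.
have: r%:R <= (n%:R - l%:R) * s.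
  rewrite -snr mulrC ler_wpM2r ?(ltW s_gt0) //.
  by rewrite lerD2l lerN2 ler_nat ltnW.
by apply: le_trans; rewrite ler_nat.
Qed.

Lemma scaled_sectionE : p = \poly_(k < r.+1) a k.
Proof.
rewrite /p /binomial_section raddf_sum /= poly_def; apply: eq_bigr => k _.
by rewrite comp_polyZ comp_Xn_poly exprZn scalerA.
Qed.

Lemma horner_scaled_section z :
  p.[z] = (1 + s * z) ^+ n - a r * z ^+ r * T.[z].
Proof.
apply/eqP; rewrite eq_sym subr_eq; apply/eqP.
rewrite exprDn scaled_sectionE !horner_poly.
rewrite -(big_mkord xpredT (fun i => 1 ^+ (n - i) * (s * z) ^+ i *+ 'C(n, i))).
have E i : 1 ^+ (n - i) * (s * z) ^+ i *+ 'C(n, i) = a i * z ^+ i.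
  by rewrite expr1n mul1r exprMn -mulr_natl mulrA.
rewrite (big_cat_nat (n := r.+1)) //=; last by rewrite ltnS ltnW.
rewrite big_mkord; congr (_ + _); first by apply: eq_bigr => i _; rewrite E.
(* The degrees [r+1, ..., n] are re-indexed from [0]; peeling off the zero constant coefficient of
   [T] aligns the two sums. *)
rewrite -{1}(add0n r.+1) big_addn subSS big_mkord big_ord_recl /= mul0r add0r.
rewrite mulr_sumr; apply: eq_bigr => i _.
rewrite E addnS -addSn addnC exprD /bump leq0n add1n.
have := scaled_coef_gt0 (ltnW r_lt_n); move/gt_eqF => ar0.
move: (a r) (a (r + i.+1)) (z ^+ r) (z ^+ i.+1) ar0 => c d u v c0; field; by rewrite c0.
Qed.

(** Valid for every [m]: past the cutoff [n - r] the binomial coefficient vanishes. *)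
Lemma coef_scaled_tailS m : T`_m.+1 = a (r + m.+1) / a r.
Proof.
rewrite coef_poly ltnS; case: leqP => //= nm.
by rewrite /a bin_small ?mul0r // addnS ltnS -leq_subLR.
Qed.

Lemma coef_scaled_tail0 : T`_0 = 0.
Proof. by rewrite coef_poly. Qed.

Lemma scaled_tail_nneg : T \is a polyOver Num.nneg.
Proof.
apply/polyOverP => -[|m]; first by rewrite coef_scaled_tail0 rpred0.
by rewrite coef_scaled_tailS nnegrE divr_ge0 ?scaled_coef_ge0.
Qed.

Let V : {poly K} := 'X * (1 + s *: 'X) * T^`().

(** Coefficientwise this is the recurrence [(r+m+1) b_(m+1) = (r - s m) b_m] with [b_0 = 1]. Since
    [T] has constant coefficient [0] instead, the source term [r X] appears. *)
Lemma scaled_tail_ode : r%:R *: ((1 - 'X) * T) = r%:R *: 'X - V.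
Proof.
have ar0 := scaled_coef_gt0 (ltnW r_lt_n).
have rec m : (r%:R + m.+1%:R) * T`_m.+1
    = (r%:R - s * m%:R) * (if m == 0%N then 1 else T`_m).
  rewrite coef_scaled_tailS mulrA -natrD addnS scaled_coefS.
  case: m => [|m] /=.
    by rewrite mulr0 subr0 addn0 mulr1 mulfK ?gt_eqF // mulrC snr.
  have e : (n%:R - (r + m.+1)%:R) * s = r%:R - s * m.+1%:R.
    by rewrite natrD -[X in _ = X - _]snr; ring.
  by rewrite e coef_scaled_tailS [RHS]mulrA.
apply/polyP => m; rewrite /V.
rewrite mulrBl mul1r coefZ 2!coefB coefXM coefZ coefX -mulrA coefXM mulrDl mul1r.
rewrite coefD -scalerAl coefZ coefXM !coef_deriv.
case: m => [|[|m]] /=.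
- by rewrite coef_scaled_tail0; ring.
- have := rec 0%N; rewrite coef_scaled_tail0 /= => h.
  have -> : T`_1 *+ 1 = (r%:R + 1%:R) * T`_1 - r%:R * T`_1 by ring.
  by rewrite h; ring.
have /= h := rec m.+1.
have -> : T`_m.+2 *+ m.+2 = (r%:R + m.+2%:R) * T`_m.+2 - r%:R * T`_m.+2 by ring.
by rewrite h; ring.
Qed.

Let V_nneg : V \is a polyOver Num.nneg.
Proof.
have sn : (s *: 'X : {poly K}) \is a polyOver Num.nneg.
  by rewrite polyOverZ ?polyOverX // nnegrE ltW.
apply: polyOver_mulr_2closed; last first.
  by apply: polyOver_deriv; apply: scaled_tail_nneg.
apply: polyOver_mulr_2closed; first exact: polyOverX.
by apply: (polyOver_addr_closed _).2 => //; apply: polyOver_mul1_closed.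
Qed.

Let horner_tail_ode z : r%:R * ((1 - z) * T.[z]) = r%:R * z - V.[z].
Proof.
have := congr1 (horner^~ z) scaled_tail_ode.
by rewrite /= -polyC1 !(hornerZ, hornerM, hornerD, hornerN, hornerX, hornerC).
Qed.

Let horner_VE z : V.[z] = z * (1 + s * z) * T^`().[z].
Proof.
by rewrite /V -polyC1 !(hornerZ, hornerM, hornerD, hornerN, hornerX, hornerC).
Qed.

(** At [1] the left side of the equation vanishes, which leaves [V.[1] = r]. *)
Lemma horner_tail_deriv1 : (1 + s) * T^`().[1] = r%:R.
Proof.
have := horner_tail_ode 1; rewrite horner_VE => h.
have e : r%:R - (1 + s) * T^`().[1] = r%:R * ((1 - 1) * T.[1]) by rewrite h; ring.
by apply/esym/eqP; rewrite -subr_eq0 e subrr mul0r mulr0.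
Qed.

Lemma horner_tail_deriv1_le : T^`().[1] <= r%:R.
Proof.
rewrite -horner_tail_deriv1 mulrDl mul1r lerDl mulr_ge0 ?(ltW s_gt0) //.
rewrite (le_trans _ (ler_norm_horner1 (z := 0) _ _)) ?normr0 //.
by rewrite polyOver_deriv // scaled_tail_nneg.
Qed.

(* [V'] has nonnegative coefficients, so [`|V'.[z]| <= V'.[1]], and the
   differentiated equation at [1] gives [V'.[1] = r (1 + T.[1])]. *)
Lemma tail_estimate z : `|z| <= 1 ->
  r%:R * `|(1 - z) * ((1 - z) * T.[z] - z)| <= (1 + s) * (2 * (1 + T.[1])).
Proof.
move=> z1.
have r0 : 0 < r%:R :> K by rewrite ltr0n.
have dE x : r%:R * ((1 - x) * T^`().[x]) = r%:R * (1 + T.[x]) - V^`().[x].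
  have /(congr1 (horner^~ x)) := congr1 (@deriv _) scaled_tail_ode.
  rewrite derivB !derivZ derivM derivB derivX -polyC1 derivC.
  rewrite !(hornerZ, hornerM, hornerD, hornerN, hornerX, hornerC) => h.
  have -> : V^`().[x] = r%:R - (r%:R * 1 - V^`().[x]) by ring.
  by rewrite -h; ring.
(* Both terms on the right of [dE] are bounded by their values at [1], where [dE] makes them equal;
   hence the factor [2]. *)
have T'z : `|(1 - z) * T^`().[z]| <= 2 * (1 + T.[1]).
  rewrite -(ler_pM2l r0) -{1}(ger0_norm (ltW r0)) -normrM dE.
  apply: (le_trans (ler_normB _ _)).
  have -> : r%:R * (2 * (1 + T.[1])) = r%:R * (1 + T.[1]) + V^`().[1].
    by have := dE 1; rewrite subrr mul0r mulr0 => /esym/eqP; rewrite subr_eq0 => /eqP <-; ring.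
  apply: lerD; last by apply: ler_norm_horner1; rewrite ?polyOver_deriv.
  rewrite normrM ger0_norm ?ler0n // ler_wpM2l ?ler0n //.
  apply: (le_trans (ler_normD _ _)); rewrite normr1 lerD2l.
  by apply: ler_norm_horner1 => //; apply: scaled_tail_nneg.
have := horner_tail_ode z; rewrite horner_VE => h.
rewrite -{1}(ger0_norm (ltW r0)) -normrM.
(* The undifferentiated equation times [1 - z] turns the error into a multiple of [(1 - z) T'], and
   [|z (1 + s z)| <= 1 + s]. *)
have -> : r%:R * ((1 - z) * ((1 - z) * T.[z] - z))
   = - (z * (1 + s * z) * ((1 - z) * T^`().[z])).
  have -> : r%:R * ((1 - z) * ((1 - z) * T.[z] - z))
    = (1 - z) * (r%:R * ((1 - z) * T.[z]) - r%:R * z) by ring.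
  by rewrite h; ring.
rewrite normrN normrM ler_pM //.
rewrite normrM -[leRHS]mul1r ler_pM //.
apply: (le_trans (ler_normD _ _)); rewrite normr1 lerD2l normrM.
by rewrite ger0_norm ?(ltW s_gt0) // ler_piMr // ltW.
Qed.

(* Bernoulli: [T.[1] <= T.[1 - u] + u * T'.[1]]; at [u = r^(-1/2)] this is
   [O(sqrt r)], which makes [tail_estimate] useful. *)
Lemma horner_tail1_le u : 0 < u <= 1 -> T.[1] <= u^-1 + u * r%:R.
Proof.
move=> /andP[u0 u1].
have r0 : 0 < r%:R :> K by rewrite ltr0n.
have v0 : 0 <= 1 - u by rewrite subr_ge0.
apply: (@le_trans _ _ (T.[1 - u] + u * T^`().[1])).
  have Tn : forall i, 0 <= T`_i by move=> i; have /polyOverP := scaled_tail_nneg; exact.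
  have -> : T^`().[1] = \sum_(i < size T) T`_i *+ i.
    rewrite (@horner_coef_wide _ (size T)); last first.
      by apply: leq_trans (size_poly _ _) _; exact: leq_pred.
    case E: (size T) => [|m]; first by rewrite !big_ord0.
    rewrite [RHS]big_ord_recl mulr0n add0r big_ord_recr /= expr1n mulr1.
    rewrite coef_deriv [T`_m.+1]nth_default ?E // mul0rn addr0.
    by apply: eq_bigr => i _; rewrite expr1n mulr1 coef_deriv.
  rewrite !horner_coef mulr_sumr -big_split /=; apply: ler_sum => i _.
  rewrite expr1n -mulr_natr mulrCA -mulrDr ler_wpM2l //.
  (* Termwise claim: [1 <= (1 - u)^i + u i], by induction. *)
  elim: {i}(i : nat) => [|i IH]; first by rewrite expr0 mulr0 addr0.
  have : 0 <= (1 - u) ^+ i <= 1.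
    by rewrite exprn_ge0 // exprn_ile1 // lerBlDr lerDl ltW.
  move=> /andP[w0 w1]; apply: (le_trans IH).
  rewrite exprS -subr_ge0.
  have -> : (1 - u) * (1 - u) ^+ i + u * i.+1%:R - ((1 - u) ^+ i + u * i%:R)
     = u * (1 - (1 - u) ^+ i) by ring.
  by rewrite mulr_ge0 ?subr_ge0 // ltW.
apply: lerD; last by rewrite ler_pM2l // horner_tail_deriv1_le.
(* At [1 - u] the equation reads [r u T = r (1 - u) - V <= r], since [V >= 0]; hence [T.[1 - u] <=
   1/u]. *)
have h := horner_tail_ode (1 - u).
have V0 : 0 <= V.[1 - u].
  rewrite horner_coef sumr_ge0 // => i _.
  by rewrite mulr_ge0 ?exprn_ge0 //; have /polyOverP := V_nneg; exact.
rewrite -(ler_pM2l u0) divff ?gt_eqF // -(ler_pM2l r0) mulr1.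
have -> : r%:R * (u * T.[1 - u]) = r%:R * ((1 - (1 - u)) * T.[1 - u]) by ring.
rewrite h -subr_ge0.
have -> : r%:R - (r%:R * (1 - u) - V.[1 - u]) = r%:R * u + V.[1 - u] by ring.
by rewrite addr_ge0 // mulr_ge0 // ltW.
Qed.

Lemma horner_binomial1 : (1 + s) ^+ n = p.[1] + a r * T.[1].
Proof.
have := horner_scaled_section 1; rewrite expr1n !mulr1 => ->; ring.
Qed.

Lemma horner_tail1_ge0 : 0 <= T.[1].
Proof.
have z1 : `|0 : K| <= 1 by rewrite normr0 ler01.
exact: le_trans (normr_ge0 _) (ler_norm_horner1 scaled_tail_nneg z1).
Qed.

(** [a r] is one of the nonnegative terms of the expansion of [(1 + s)^n]. *)
Lemma scaled_coef_le : a r <= (1 + s) ^+ n.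
Proof.
rewrite horner_binomial1 scaled_sectionE horner_poly big_ord_recr /= expr1n mulr1.
rewrite -addrA addrCA lerDl addr_ge0 //.
  by rewrite sumr_ge0 // => i _; rewrite expr1n mulr1 scaled_coef_ge0.
by apply: mulr_ge0; [exact: scaled_coef_ge0|exact: horner_tail1_ge0].
Qed.

(** The section at [1] has [r+1] terms, each at most [a r], and [T.[1] <= r+1] by [horner_tail1_le]
    at [u = 1]. The loss is linear in [r], so it disappears under [r]-th roots. *)
Lemma scaled_coef_ge : (1 + s) ^+ n <= 2 * r.+1%:R * a r.
Proof.
have T1 : T.[1] <= r.+1%:R.
  apply: (le_trans (@horner_tail1_le 1 _)); first by rewrite ltr01 lexx.
  by rewrite invr1 mul1r -natr1 addrC.
rewrite horner_binomial1 -mulrA mulr_natl mulr2n; apply: lerD; last first.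
  by rewrite mulrC ler_wpM2r // scaled_coef_ge0.
rewrite scaled_sectionE horner_poly.
apply: (@le_trans _ _ (\sum_(i < r.+1) a r)); last first.
  by rewrite sumr_const card_ord mulr_natl.
apply: ler_sum => i _; rewrite expr1n mulr1 scaled_coef_homo // leqnn andbT.
by rewrite -ltnS.
Qed.

(** The coefficients of degree below [r] match by [scaled_coefS]; the truncation leaves a source
    term in degree [r] only. *)
Lemma scaled_section_ode z :
  (1 + s * z) * p^`().[z] = r%:R * (1 + s) * p.[z] - r%:R * a r * z ^+ r.
Proof.
have e : (1 + s *: 'X) * p^`()
    = (r%:R * (1 + s)) *: p - (r%:R * a r) *: 'X^r.
  rewrite scaled_sectionE; apply/polyP => k.
  rewrite mulrDl mul1r -scalerAl coefD coefB !coefZ coefXM !coef_deriv coefXn.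
  rewrite !coef_poly !ltnS.
  have sk : s * (if k == 0%N then 0 else (if (k.-1.+1 <= r)%N then a k.-1.+1
     else 0) *+ k.-1.+1) = s * k%:R * (if (k <= r)%N then a k else 0).
    case: k => [|k] /=; first by rewrite !mulr0 mul0r.
    by rewrite -[in LHS]mulr_natr [in LHS]mulrA mulrAC.
  rewrite sk -nsE -[X in X + _]mulr_natl.
  case: ltngtP => [kr|rk|->] /=.
  - by rewrite scaled_coefS; move: (a k) => c; ring.
  - by ring.
  - have e : s * r%:R = n%:R * s - r%:R by rewrite -[X in _ - X]snr; ring.
    by rewrite mulr0 add0r e mulr1 mulrBl.
have := congr1 (horner^~ z) e.
by rewrite -polyC1 !(hornerZ, hornerM, hornerD, hornerN, hornerX, hornerC, hornerXn).
Qed.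

(** [E] has degree at most [r] and coefficients [a_k - a_(k-1) >= 0] with sum [a_r]. If [|z| > 1]
    then [|E(z)| <= a_r |z|^r], whereas a root gives [E(z) = a_r z^(r+1)]. *)
Lemma scaled_section_root_le1 z : root p z -> `|z| <= 1.
Proof.
have ar0 := scaled_coef_gt0 (ltnW r_lt_n).
move=> /rootP pz; rewrite real_leNgt ?normr_real ?real1 //; apply/negP => z1.
pose E := a r *: 'X^(r.+1) - ('X - 1) * p.
have EE k : E`_k = if (k <= r)%N then a k - (if k == 0%N then 0 else a k.-1) else 0.
  rewrite /E coefB coefZ coefXn mulrBl mul1r coefB coefXM scaled_sectionE.
  rewrite !coef_poly !ltnS; case: k => [|k] /=; first by ring.
  by rewrite eqSS; case: ltngtP => [kr|rk|->]; rewrite ?(ltnW kr) //=; ring.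
have szE : (size E <= r.+1)%N.
  by apply/leq_sizeP => k rk; rewrite EE leqNgt rk.
have E0 k : 0 <= E`_k.
  rewrite EE; case: ifP => // kr; case: k kr => [|k] kr /=.
    by rewrite subr0 scaled_coef_ge0.
  by rewrite subr_ge0 scaled_coef_homo // leqnSn.
have Ez : E.[z] = a r * z ^+ r.+1.
  by rewrite /E hornerD hornerN hornerM pz mulr0 subr0 hornerZ hornerXn.
have E1 : E.[1] = a r.
  rewrite /E hornerD hornerN hornerM hornerD hornerN hornerX -polyC1 hornerC.
  by rewrite subrr mul0r subr0 hornerZ hornerXn expr1n mulr1.
have : `|E.[z]| <= `|z| ^+ r * E.[1].
  rewrite !(horner_coef_wide _ szE) mulr_sumr.
  apply: (le_trans (ler_norm_sum _ _ _)); apply: ler_sum => i _.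
  rewrite expr1n mulr1 normrM normrX ger0_norm // mulrC ler_wpM2r //.
  by rewrite ler_eXn2l // -ltnS.
rewrite Ez E1 normrM normrX (gtr0_norm ar0) mulrC ler_pM2r // ler_eXn2l //.
by rewrite ltnn.
Qed.
End Scaled.

(** * Logarithmic derivatives as sums over the roots *)

Lemma logderiv_prod_XsubC (K : fieldType) (s : seq K) (x : K) :
  x \notin s ->
  (\prod_(w <- s) ('X - w%:P))^`().[x] / (\prod_(w <- s) ('X - w%:P)).[x]
  = \sum_(w <- s) (x - w)^-1.
Proof.
elim: s => [|w s IH]; first by rewrite !big_nil derivC horner0 mul0r.
rewrite inE negb_or => /andP[xw xs]; rewrite !big_cons -(IH xs).
rewrite derivM derivXsubC mul1r hornerD !hornerM hornerXsubC.
have xw0 : x - w != 0 by rewrite subr_eq0.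
have P0 : (\prod_(v <- s) ('X - v%:P)).[x] != 0.
  by have := xs; rewrite -root_prod_XsubC rootE.
by field; rewrite xw0 P0.
Qed.

(** Each of the at most [d] roots contributes [1/(x-w) - 1/(y-w) = (y-x)/((x-w)(y-w))], so only the
    distances at the two endpoints matter. *)
Lemma logderiv_lipschitz (C : numClosedFieldType) (p : {poly C}) (d : nat)
    (x y rho : C) :
  0 < rho -> p != 0 -> (size p <= d.+1)%N ->
  (forall w, root p w -> rho <= `|x - w| /\ rho <= `|y - w|) ->
  `|p^`().[x] / p.[x] - p^`().[y] / p.[y]| <= d%:R * (`|x - y| / rho ^+ 2).
Proof.
move=> rho0 p0 sp far.
have [s ps] := closed_field_poly_normal p.
have l0 : lead_coef p != 0 by rewrite lead_coef_eq0.
have {}far w : w \in s -> rho <= `|x - w| /\ rho <= `|y - w|.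
  by move=> ws; apply: far; rewrite ps rootZ // root_prod_XsubC.
have out z : (forall w, w \in s -> rho <= `|z - w|) -> z \notin s.
  by move=> h; apply/negP => /h; rewrite subrr normr0 lt_geF.
have xs : x \notin s by apply: out => w /far[].
have ys : y \notin s by apply: out => w /far[].
have E z : z \notin s -> p^`().[z] / p.[z] = \sum_(w <- s) (z - w)^-1.
  move=> zs; rewrite -logderiv_prod_XsubC // {1 2}ps derivZ !hornerZ.
  by rewrite -mulf_div divff // mul1r.
rewrite !E // -sumrB; apply: (le_trans (ler_norm_sum _ _ _)).
have sz : (size s <= d)%N.
  by move: sp; rewrite ps size_scale // size_prod_XsubC ltnS.
apply: (@le_trans _ _ (\sum_(w <- s) `|x - y| / rho ^+ 2)).
  rewrite big_seq [leRHS]big_seq; apply: ler_sum => w ws.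
  have [fx fy] := far w ws.
  have x0 : x - w != 0 by apply: contraNneq xs => /eqP; rewrite subr_eq0 => /eqP ->.
  have y0 : y - w != 0 by apply: contraNneq ys => /eqP; rewrite subr_eq0 => /eqP ->.
  have -> : (x - w)^-1 - (y - w)^-1 = (y - x) / ((x - w) * (y - w)).
    by field; rewrite x0 y0.
  rewrite normf_div distrC ler_wpM2l // lef_pV2 ?posrE ?normr_gt0 ?mulf_neq0 //.
    by rewrite normrM expr2 ler_pM // ltW.
  by rewrite exprn_gt0.
rewrite big_const_seq count_predT iter_addr_0 -[leLHS]mulr_natl.
by rewrite ler_wpM2r ?ler_nat // divr_ge0 // exprn_ge0 // ltW.
Qed.

(* Stated over an abstract [K] so that it can be used at [K := R[i]], which has
   no topology of its own. *)
Definition converges (K : numFieldType) (u : nat -> K) (l : K) : Prop :=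
  u @ \oo --> l.

(** * Limits of the tail and of the logarithmic derivative *)

Section NumFieldLimits.
Variable K : numFieldType.
Implicit Types (u z e T s Y : nat -> K) (a b l zeta : K).

Lemma converges_cst a : converges (fun=> a) a.
Proof. exact: cvg_cst. Qed.

Lemma converges_dist u v a b c : converges u a -> converges v b ->
  0 <= c < `|a - b| -> \forall j \near \oo, c < `|u j - v j|.
Proof.
move=> ua vb /andP[c0 cab].
have h0 : 0 < (`|a - b| - c) / 2 by rewrite divr_gt0 // subr_gt0.
have /cvgr_dist_lt/(_ _ h0) Hu := ua.
have /cvgr_dist_lt/(_ _ h0) Hv := vb.
near=> j.
have hu : `|a - u j| < (`|a - b| - c) / 2 by near: j.
have hv : `|b - v j| < (`|a - b| - c) / 2 by near: j.
have t1 : `|a - b| <= `|a - u j| + `|u j - v j| + `|b - v j|.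
  have -> : a - b = (a - u j) + (u j - v j) - (b - v j) by ring.
  apply: (le_trans (ler_normB _ _)); rewrite lerD2r.
  exact: ler_normD.
have : `|a - u j| + `|b - v j| < `|a - b| - c.
  by have := ltrD hu hv; rewrite -splitr.
rewrite ltrBrDr => t2; have := lt_le_trans t2 t1.
by rewrite [X in _ < X]addrAC ltrD2l.
Unshelve. all: by end_near. Qed.

Lemma converges_neq0 u a : converges u a -> a != 0 -> \forall j \near \oo, u j != 0.
Proof.
move=> ua a0; have a_gt0 : 0 < `|a| by rewrite normr_gt0.
have /cvgr_dist_lt/(_ _ a_gt0) := ua; apply: filterS => j.
by apply: contraTneq => ->; rewrite subr0 ltxx.
Qed.

(** Where [1 - z] is nonzero, [T = (z + e/(1-z))/(1-z)]; the quantity [e] is the one bounded by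
    [tail_estimate]. *)
Lemma tail_limit e z T zeta : zeta != 1 -> converges e 0 -> converges z zeta ->
  (\forall j \near \oo, (1 - z j) * ((1 - z j) * T j - z j) = e j) ->
  converges T (zeta / (1 - zeta)).
Proof.
rewrite /converges => z1 e0 zz eE.
have w0 : 1 - zeta != 0 by rewrite subr_eq0 eq_sym.
have ww : (1 - z j) @[j --> \oo] --> 1 - zeta by apply: cvgB => //; apply: cvg_cst.
have wV : (1 - z j)^-1 @[j --> \oo] --> (1 - zeta)^-1 by apply: cvgV.
have L : (z j + e j * (1 - z j)^-1) * (1 - z j)^-1 @[j --> \oo]
   --> (zeta + 0 * (1 - zeta)^-1) * (1 - zeta)^-1.
  exact: cvgM (cvgD zz (cvgM e0 wV)) wV.
move: L; rewrite mul0r addr0; apply: cvg_trans; apply: near_eq_cvg.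
have Hw := converges_neq0 ww w0.
near=> j; have wj : 1 - z j != 0 by near: j.
have <- : (1 - z j) * ((1 - z j) * T j - z j) = e j by near: j.
by field.
Unshelve. all: by end_near. Qed.

(* The logarithmic derivative [q] is read off [(1 + s z) q = (1 + s) - a z^r / p]. *)
Lemma logderiv_limit_inside z s Y T (q : nat -> K) t : converges s 0 ->
  converges Y 0 -> converges T t ->
  (\forall j \near \oo, 1 - Y j * T j != 0 ->
     (1 + s j * z j) * q j = (1 + s j) - Y j / (1 - Y j * T j)) ->
  forall zeta, converges z zeta -> converges q 1.
Proof.
rewrite /converges => s0 Y0 Tt qE zeta zz.
have c1 : (fun _ : nat => 1 : K) @ \oo --> (1 : K) by apply: cvg_cst.
have d : (1 + s j * z j) @[j --> \oo] --> 1 + 0 * zeta.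
  exact: cvgD c1 (cvgM s0 zz).
have YT : (1 - Y j * T j) @[j --> \oo] --> 1 - 0 * t.
  exact: cvgB c1 (cvgM Y0 Tt).
have YTV : (1 - Y j * T j)^-1 @[j --> \oo] --> (1 - 0 * t)^-1.
  by apply: cvgV => //; rewrite mul0r subr0 oner_eq0.
have dV : (1 + s j * z j)^-1 @[j --> \oo] --> (1 + 0 * zeta)^-1.
  by apply: cvgV => //; rewrite mul0r addr0 oner_eq0.
have L : ((1 + s j) - Y j * (1 - Y j * T j)^-1) * (1 + s j * z j)^-1 @[j --> \oo]
   --> ((1 + 0) - 0 * (1 - 0 * t)^-1) * (1 + 0 * zeta)^-1.
  exact: cvgM (cvgB (cvgD c1 s0) (cvgM Y0 YTV)) dV.
move: L; rewrite !mul0r subr0 !addr0 invr1 mulr1; apply: cvg_trans.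
apply: near_eq_cvg.
have Hw := converges_neq0 d _; have HYT := converges_neq0 YT _.
rewrite !mul0r addr0 subr0 oner_eq0 in Hw HYT.
near=> j; have wj : 1 + s j * z j != 0 by near: j; exact: Hw.
have YTj : 1 - Y j * T j != 0 by near: j; exact: HYT.
have <- : (1 + s j * z j) * q j = (1 + s j) - Y j / (1 - Y j * T j).
  by move: YTj; near: j.
by rewrite mulrC mulKf.
Unshelve. all: by end_near. Qed.

(** Here [W] stands for [(1 + s z)^n / (a z^r)], so [a z^r / p = 1/(W - T)] tends to
    [-(1 - zeta)/zeta], and [1 + (1 - zeta)/zeta = 1/zeta]. *)
Lemma logderiv_limit_outside z s W T (q : nat -> K) zeta : zeta != 0 -> zeta != 1 ->
  converges s 0 -> converges W 0 -> converges T (zeta / (1 - zeta)) ->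
  (\forall j \near \oo, W j - T j != 0 ->
     (1 + s j * z j) * q j = (1 + s j) - 1 / (W j - T j)) ->
  converges z zeta -> converges q zeta^-1.
Proof.
rewrite /converges => z0 z1 s0 W0 Tt qE zz.
have w0 : 1 - zeta != 0 by rewrite subr_eq0 eq_sym.
have c1 : (fun _ : nat => 1 : K) @ \oo --> (1 : K) by apply: cvg_cst.
have d : (1 + s j * z j) @[j --> \oo] --> 1 + 0 * zeta.
  exact: cvgD c1 (cvgM s0 zz).
have WT : (W j - T j) @[j --> \oo] --> 0 - zeta / (1 - zeta).
  exact: cvgB W0 Tt.
have WTV : (W j - T j)^-1 @[j --> \oo] --> (0 - zeta / (1 - zeta))^-1.
  by apply: cvgV => //; rewrite sub0r oppr_eq0 mulf_neq0 // invr_eq0.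
have dV : (1 + s j * z j)^-1 @[j --> \oo] --> (1 + 0 * zeta)^-1.
  by apply: cvgV => //; rewrite mul0r addr0 oner_eq0.
have L : ((1 + s j) - (W j - T j)^-1) * (1 + s j * z j)^-1 @[j --> \oo]
   --> ((1 + 0) - (0 - zeta / (1 - zeta))^-1) * (1 + 0 * zeta)^-1.
  exact: cvgM (cvgB (cvgD c1 s0) WTV) dV.
have -> : zeta^-1 = ((1 + 0) - (0 - zeta / (1 - zeta))^-1) * (1 + 0 * zeta)^-1.
  by rewrite mul0r !addr0; field; rewrite z0 w0 ?oner_eq0.
apply: cvg_trans L; apply: near_eq_cvg.
have Hw := converges_neq0 d _; have HWT := converges_neq0 WT _.
rewrite mul0r addr0 oner_eq0 in Hw.
rewrite sub0r oppr_eq0 mulf_neq0 ?invr_eq0 // in HWT.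
near=> j; have wj : 1 + s j * z j != 0 by near: j; exact: Hw.
have WTj : W j - T j != 0 by near: j; exact: HWT.
rewrite -[X in _ - X]div1r.
have <- : (1 + s j * z j) * q j = (1 + s j) - 1 / (W j - T j).
  by move: WTj; near: j.
by rewrite mulrC mulKf.
Unshelve. all: by end_near. Qed.
End NumFieldLimits.

(** * Real-valued norms and convergence in [R[i]] *)

Section ComplexReal.
Variable R : realType.
Implicit Types (u : nat -> R[i]) (l z w : R[i]).
Local Notation nc := (@ComplexField.Normc.normc R).

Lemma normcE_real z : `|z| = (nc z)%:C.
Proof. by case: z. Qed.

Lemma normc_ge0 z : 0 <= nc z.
Proof. by rewrite -lecR -normcE_real normr_ge0. Qed.

Lemma normc_eq0 z : (nc z == 0) = (z == 0).
Proof.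
by apply/eqP/eqP => [/ComplexField.Normc.eq0_normc//|->]; rewrite ComplexField.Normc.normc0.
Qed.

Lemma normcX z k : nc (z ^+ k) = nc z ^+ k.
Proof.
elim: k => [|k IH]; first exact: ComplexField.Normc.normc1.
by rewrite !exprS ComplexField.Normc.normcM IH.
Qed.

Lemma normc_real (x : R) : 0 <= x -> nc x%:C = x.
Proof. by move=> x0; rewrite /= expr0n addr0 sqrtr_sqr ger0_norm. Qed.

Lemma normc_distB z w : nc (z - w) = nc (w - z).
Proof. by rewrite -opprB normcN. Qed.

Lemma ler_normc_dist z w : `|nc z - nc w| <= nc (z - w).
Proof.
have H x y : nc x <= nc y + nc (x - y).
  by have := le_normcD y (x - y); rewrite addrC subrK.
rewrite ler_norml; have := H z w; have := H w z.
rewrite (normc_distB w z) => ? ?; lra.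
Qed.

Lemma ler_Re_dist z w : `|complex.Re z - complex.Re w| <= nc (z - w).
Proof. by have := normc_ge_Re (z - w); rewrite normcE_real lecR; case: z w => ? ? []. Qed.

(** A positive element of [R[i]] is real, so radii in [R[i]] and in [R] are the same. *)
Lemma convergesP u l :
  converges (K := R[i]) u l <-> (nc (u j - l)) @[j --> \oo] --> (0 : R).
Proof.
split=> [/cvgrPdist_lt H|/cvgr0Pnorm_lt H].
  apply/cvgr0Pnorm_lt => e e0.
  have eC : 0 < e%:C :> R[i] by rewrite ltcR.
  have := H _ eC; apply: filterS => j.
  by rewrite normcE_real ltcR normc_distB ger0_norm ?normc_ge0.
apply/cvgrPdist_lt => e e0.
have eR : e = (complex.Re e)%:C by rewrite RRe_real // gtr0_real.
have e1 : 0 < complex.Re e by rewrite -ltcR -eR.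
have := H _ e1; apply: filterS => j.
by rewrite normcE_real eR ltcR normc_distB ger0_norm ?normc_ge0.
Qed.

Lemma converges_normc u l : converges (K := R[i]) u l ->
  nc (u j) @[j --> \oo] --> nc l.
Proof.
move=> /convergesP/cvgr0Pnorm_lt H; apply/cvgrPdist_lt => e e0.
have := H e e0; apply: filterS => j; rewrite ger0_norm ?normc_ge0 //.
by apply: le_lt_trans; rewrite distrC ler_normc_dist.
Qed.

Lemma converges_Re u l : converges (K := R[i]) u l ->
  complex.Re (u j) @[j --> \oo] --> complex.Re l.
Proof.
move=> /convergesP/cvgr0Pnorm_lt H; apply/cvgrPdist_lt => e e0.
have := H e e0; apply: filterS => j; rewrite ger0_norm ?normc_ge0 //.
by apply: le_lt_trans; rewrite distrC ler_Re_dist.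
Qed.

Lemma converges_normc0 u : nc (u j) @[j --> \oo] --> (0 : R) ->
  converges (K := R[i]) u 0.
Proof. by move=> H; apply/convergesP; under eq_fun do rewrite subr0. Qed.

Lemma converges_real (x : nat -> R) (l : R) : x @ \oo --> l ->
  converges (K := R[i]) (fun j => (x j)%:C) l%:C.
Proof.
move=> xl; apply/convergesP.
under eq_fun do rewrite -rmorphB /= expr0n addr0 sqrtr_sqr.
by apply/norm_cvg0P/subr_cvg0.
Qed.
End ComplexReal.

(** * Geometric decay against a linear factor *)

Lemma linear_geometric_le (R : realFieldType) (q : R) : 0 < q < 1 ->
  exists c p : R, 0 <= p < 1 /\ forall k, k.+1%:R * q ^+ k <= c * p ^+ k.
Proof.
move=> /andP[q0 q1]; pose p := (1 + q) / 2; pose t := p / q - 1.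
have p0 : 0 < p by rewrite /p; lra.
have t0 : 0 < t.
  by rewrite /t subr_gt0 ltr_pdivlMr // mul1r /p; lra.
(* With [p = (1 + t) q], Bernoulli gives [(1 + t)^k >= 1 + k t], and
   [(1/t + 1)(1 + k t) >= k + 1]. *)
exists (t^-1 + 1), p; split; first by rewrite ltW //= /p; lra.
have bern k : 1 + k%:R * t <= (1 + t) ^+ k.
  elim: k => [|k IH]; first by rewrite mul0r addr0 expr0.
  have t1 : 0 <= 1 + t by lra.
  rewrite exprS; apply: (le_trans _ (ler_wpM2l t1 IH)); rewrite -subr_ge0.
  have -> : (1 + t) * (1 + k%:R * t) - (1 + k.+1%:R * t) = k%:R * t ^+ 2.
    by rewrite -natr1; ring.
  by rewrite mulr_ge0 ?ler0n // exprn_ge0 // ltW.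
move=> k; have -> : p = (1 + t) * q by rewrite /t addrCA subrr addr0 divfK // gt_eqF.
rewrite exprMn mulrA ler_wpM2r ?exprn_ge0 ?(ltW q0) //.
have c0 : 0 <= t^-1 + 1 by rewrite addr_ge0 // invr_ge0 ltW.
apply: (le_trans _ (ler_wpM2l c0 (bern k))); rewrite -subr_ge0.
have -> : (t^-1 + 1) * (1 + k%:R * t) - k.+1%:R = t^-1 + k%:R * t.
  by rewrite -natr1; field; rewrite gt_eqF.
by rewrite addr_ge0 ?invr_ge0 ?mulr_ge0 ?ler0n // ltW.
Qed.

(** Eventually [b j] stays below the fixed ratio [(1 + l)/2 < 1]. The factor [2 (r+1)] is the loss
    in [scaled_coef_ge]. *)
Lemma cvg_linear_geometric (R : realType) (r : nat -> nat) (b : nat -> R) (l : R) :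
  r @ \oo --> \oo -> (forall j, 0 <= b j) -> b @ \oo --> l -> l < 1 ->
  (2 * (r j).+1%:R * b j ^+ r j) @[j --> \oo] --> (0 : R).
Proof.
move=> roo b0 bl l1.
have l0 : 0 <= l by apply: (cvgr_to_ge bl); exact: nearW.
have q01 : 0 < (1 + l) / 2 < 1 by apply/andP; split; lra.
have [c [p [/andP[p0 p1] Hc]]] := linear_geometric_le q01.
have P : geometric (2 * c) p (r j) @[j --> \oo] --> (0 : R).
  apply: (cvg_comp r (geometric (2 * c) p) roo); apply: cvg_geometric.
  by rewrite ger0_norm.
apply: (squeeze_cvgr _ (cvg_cst 0) P).
have lq : l < (1 + l) / 2 by lra.
have H : \forall j \near \oo, b j < (1 + l) / 2 by apply: (cvgr_lt _ bl).
near=> j; apply/andP; split; first by rewrite !mulr_ge0 ?exprn_ge0 ?ler0n.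
have bj : b j < (1 + l) / 2 by near: j.
rewrite /geometric /= -!mulrA ler_pM2l //; apply: le_trans (Hc (r j)).
rewrite ler_wpM2l ?ler0n //; apply: lerXn2r; rewrite ?nnegrE ?(ltW bj) //.
by case/andP: q01 => /ltW.
Unshelve. all: by end_near. Qed.

(** * Growth of [(1 + s z)^n] and of [a z^r] on the scale of [r]-th powers *)

Section Asymptotics.
Variable R : realType.
Local Notation nc := (@ComplexField.Normc.normc R).

Lemma normc_1D_sqr (s : R) (z : R[i]) :
  nc (1 + s%:C * z) ^+ 2 = 1 + s * (2 * complex.Re z + s * nc z ^+ 2).
Proof.
case: z => x y; rewrite /= !sqr_sqrtr ?addr_ge0 ?sqr_ge0 //.
by rewrite !mul0r subr0 addr0 add0r; ring.
Qed.

(** The lower bound is the upper one at [-t/(1+t)], as [1 - t/(1+t) = 1/(1+t)]. *)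
Lemma ln_bounds (t : R) : -1 < t -> t / (1 + t) <= ln (1 + t) <= t.
Proof.
move=> t1; rewrite le_ln1Dx // andbT.
have p : 0 < 1 + t by lra.
have h : -1 < - (t / (1 + t)).
  by rewrite ltrN2 ltr_pdivrMr // mul1r; lra.
have := le_ln1Dx h.
have -> : 1 + - (t / (1 + t)) = (1 + t)^-1 by field; rewrite gt_eqF.
by rewrite lnV ?posrE // lerN2.
Qed.

Definition scaled_step (r n : nat) : R := r%:R / (n%:R - r%:R).

Definition log_growth (r n : nat) (z : R[i]) : R :=
  n%:R / r%:R * ln (nc (1 + (scaled_step r n)%:C * z)).

Lemma normc_1D_ge (s : R) (z : R[i]) : 0 <= s -> nc z <= 1 ->
  1 - s <= nc (1 + s%:C * z).
Proof.
move=> s0 z1.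
have := ler_normc_dist (1 : R[i]) (- (s%:C * z)).
rewrite opprK normcN ComplexField.Normc.normcM ComplexField.Normc.normc1 normc_real //.
have := ler_wpM2l s0 z1; rewrite mulr1 => h1 h2.
by have := le_trans (ler_norm _) h2; lra.
Qed.

Lemma log_growthX r n z : (0 < r)%N -> 0 < nc (1 + (scaled_step r n)%:C * z) ->
  nc (1 + (scaled_step r n)%:C * z) ^+ n = expR (log_growth r n z) ^+ r.
Proof.
move=> r0 p; rewrite -expRM_natl /log_growth mulrA [r%:R * _]mulrC.
by rewrite divfK ?pnatr_eq0 -?lt0n // expRM_natl lnK.
Qed.

(** Since [n/r = (1+s)/s] and [|1 + s z|^2 = 1 + s y], the growth rate is
    [(1+s)/(2s) * ln (1 + s y)], to which [ln_bounds] applies. Both bounds tend to [Re z] as [s]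
    tends to [0]. *)
Lemma log_growth_bounds r n z : (0 < r < n)%N -> scaled_step r n < 1 -> nc z <= 1 ->
  let s := scaled_step r n in
  let y := 2 * complex.Re z + s * nc z ^+ 2 in
  is_true ((1 + s) * y / (2 * (1 + s * y)) <= log_growth r n z <= (1 + s) * y / 2).
Proof.
move=> /andP[r0 rn] s1 z1 s y.
have r0' : 0 < r%:R :> R by rewrite ltr0n.
have d0 : 0 < n%:R - r%:R :> R by rewrite subr_gt0 ltr_nat.
have s0 : 0 < s by rewrite /s divr_gt0.
have N0 : 0 < nc (1 + s%:C * z).
  by apply: lt_le_trans (normc_1D_ge (ltW s0) z1); rewrite subr_gt0.
have N2 := normc_1D_sqr s z.
have p : 0 < 1 + s * y by rewrite -N2 exprn_gt0.
have t1 : -1 < s * y by lra.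
have nr : n%:R / r%:R = (1 + s) / s.
  rewrite /s /scaled_step; move: r0' d0; move: (r%:R : R) (n%:R : R) => a b a0 ba0.
  by field; rewrite !gt_eqF.
have E : log_growth r n z = (1 + s) / (2 * s) * ln (1 + s * y).
  rewrite /log_growth -/s nr -N2 lnXn //; move: (ln _) => w.
  by clearbody s; field; rewrite gt_eqF.
rewrite E; have /andP[lb ub] := ln_bounds t1.
have c0 : 0 <= (1 + s) / (2 * s) by rewrite divr_ge0 //; lra.
have := ler_wpM2l c0 lb; have := ler_wpM2l c0 ub.
have -> : (1 + s) / (2 * s) * (s * y) = (1 + s) * y / 2.
  by field; rewrite gt_eqF.
have -> : (1 + s) / (2 * s) * (s * y / (1 + s * y)) = (1 + s) * y / (2 * (1 + s * y)).
  by field; rewrite !gt_eqF.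
by move=> -> ->.
Qed.

Lemma log_growth_cvg (r n : nat -> nat) (z : nat -> R[i]) (x m : R) :
  (forall j, (0 < r j < n j)%N) -> (forall j, nc (z j) <= 1) ->
  scaled_step (r j) (n j) @[j --> \oo] --> (0 : R) ->
  complex.Re (z j) @[j --> \oo] --> x -> nc (z j) @[j --> \oo] --> m ->
  log_growth (r j) (n j) (z j) @[j --> \oo] --> x.
Proof.
move=> rn z1 s0 zx zm.
pose s j := scaled_step (r j) (n j).
pose y j := 2 * complex.Re (z j) + s j * nc (z j) ^+ 2.
have c1 (c : R) : (fun _ : nat => c) @ \oo --> c by apply: cvg_cst.
have yl : y @ \oo --> 2 * x + 0 * (m * m).
  by rewrite /y; under eq_fun do rewrite expr2; exact: cvgD (cvgM (c1 2) zx) (cvgM s0 (cvgM zm zm)).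
have up : (1 + s j) * y j / 2 @[j --> \oo] --> (1 + 0) * (2 * x + 0 * (m * m)) / 2.
  exact: cvgM (cvgM (cvgD (c1 1) s0) yl) (c1 2^-1).
have dn : (2 * (1 + s j * y j))^-1 @[j --> \oo]
    --> (2 * (1 + 0 * (2 * x + 0 * (m * m))))^-1.
  apply: cvgV; last exact: cvgM (c1 2) (cvgD (c1 1) (cvgM s0 yl)).
  by rewrite !mul0r !addr0 mulr1.
have lo : (1 + s j) * y j / (2 * (1 + s j * y j)) @[j --> \oo]
    --> (1 + 0) * (2 * x + 0 * (m * m)) / (2 * (1 + 0 * (2 * x + 0 * (m * m)))).
  exact: cvgM (cvgM (cvgD (c1 1) s0) yl) dn.
have e : (1 + 0) * (2 * x + 0 * (m * m)) / 2 = x by field.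
have e' : (1 + 0) * (2 * x + 0 * (m * m)) / (2 * (1 + 0 * (2 * x + 0 * (m * m)))) = x.
  by rewrite -[RHS]e !mul0r !addr0 mulr1.
rewrite e in up; rewrite e' in lo.
apply: squeeze_cvgr lo up.
have H : \forall j \near \oo, scaled_step (r j) (n j) < 1 by apply: (cvgr_lt _ s0).
near=> j; apply: log_growth_bounds => //; near: j; exact: H.
Unshelve. all: by end_near. Qed.

(** The modulus of [a z^r / (1 + s z)^n], the factor in front of [T] once [p] is divided by
    [(1 + s z)^n]. *)
Definition tail_ratio (r n : nat) (z : R[i]) : R :=
  scaled_coef R r n r * nc z ^+ r / nc (1 + (scaled_step r n)%:C * z) ^+ n.

(** This is [|z e^(1-z)|] as a real number, since [|e^w| = e^(Re w)]. *)
Definition szego_fun (z : R[i]) : R := nc z * expR (1 - complex.Re z).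

(** [b^r] is [tail_ratio] with [a r] replaced by [(1 + s)^n], the growth at the point [1];
    [scaled_coef_le] and [scaled_coef_ge] compare the two. *)
Lemma tail_ratio_bounds r n z : (0 < r < n)%N -> scaled_step r n < 1 -> nc z <= 1 ->
  let b := expR (log_growth r n 1 - log_growth r n z) * nc z in
  is_true (tail_ratio r n z <= b ^+ r <= 2 * r.+1%:R * tail_ratio r n z).
Proof.
move=> /andP[r0 rn] s1 z1 b; set s := scaled_step r n.
have s0 : 0 <= s by rewrite divr_ge0 // subr_ge0 ler_nat ltnW.
have N0 : 0 < nc (1 + s%:C * z).
  by apply: lt_le_trans (normc_1D_ge s0 z1); rewrite subr_gt0.
have e1 : nc (1 + s%:C * 1) = 1 + s.
  by rewrite mulr1 -[1]/((1 : R)%:C) -rmorphD normc_real // addr_ge0.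
have N1 : 0 < nc (1 + s%:C * 1) by rewrite e1; lra.
have bE : b ^+ r = (1 + s) ^+ n * nc z ^+ r / nc (1 + s%:C * z) ^+ n.
  rewrite /b expRD expRN !exprMn exprVn -log_growthX // -log_growthX // e1.
  by rewrite mulrAC.
rewrite bE /tail_ratio -/s; apply/andP; split.
  rewrite ler_wpM2r ?invr_ge0 ?exprn_ge0 ?normc_ge0 //.
  by rewrite ler_wpM2r ?exprn_ge0 ?normc_ge0 //; apply: scaled_coef_le.
rewrite [leRHS]mulrA ler_wpM2r ?invr_ge0 ?exprn_ge0 ?normc_ge0 //.
by rewrite [leRHS]mulrA ler_wpM2r ?exprn_ge0 ?normc_ge0 //; apply: scaled_coef_ge.
Qed.

Section Sequence.
Variables (r n : nat -> nat) (z : nat -> R[i]) (zeta : R[i]).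
Hypotheses (rn : forall j, (0 < r j < n j)%N) (roo : r @ \oo --> \oo).
Hypothesis s0 : scaled_step (r j) (n j) @[j --> \oo] --> (0 : R).
Hypotheses (z1 : forall j, nc (z j) <= 1) (zz : converges (K := R[i]) z zeta).

Let b j := expR (log_growth (r j) (n j) 1 - log_growth (r j) (n j) (z j)) * nc (z j).

Let b_ge0 j : 0 <= b j.
Proof. by rewrite mulr_ge0 ?normc_ge0 // ltW // expR_gt0. Qed.

Let bl : b @ \oo --> szego_fun zeta.
Proof.
have zx := converges_Re zz; have zm := converges_normc zz.
have l1 : log_growth (r j) (n j) 1 @[j --> \oo] --> (1 : R).
  apply: (log_growth_cvg (z := fun=> 1) (m := 1)) => //.
  - by move=> j; rewrite ComplexField.Normc.normc1.
  - exact: cvg_cst.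
  - by rewrite ComplexField.Normc.normc1; exact: cvg_cst.
have lz := log_growth_cvg rn z1 s0 zx zm.
rewrite /szego_fun mulrC; apply: cvgM => //.
by apply: continuous_cvg; [exact: continuous_expR | exact: cvgB].
Qed.

Lemma tail_ratio_inside : szego_fun zeta < 1 ->
  tail_ratio (r j) (n j) (z j) @[j --> \oo] --> (0 : R).
Proof.
move=> g1; have P := cvg_linear_geometric roo b_ge0 bl g1.
apply: (squeeze_cvgr _ (cvg_cst 0) P).
have H : \forall j \near \oo, scaled_step (r j) (n j) < 1 by apply: (cvgr_lt _ s0).
near=> j; have sj : scaled_step (r j) (n j) < 1 by near: j.
have /andP[h1 _] := tail_ratio_bounds (rn j) sj (z1 j).
have /andP[rj0 rnj] := rn j.
have -> /= : 0 <= tail_ratio (r j) (n j) (z j).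
  rewrite divr_ge0 ?exprn_ge0 ?normc_ge0 // mulr_ge0 ?exprn_ge0 ?normc_ge0 //.
  exact: scaled_coef_ge0.
(* The factor [2 (r+1) >= 1] is inserted to match the form of [cvg_linear_geometric]. *)
apply: (le_trans h1); rewrite -/(b j) ler_peMl ?exprn_ge0 //.
by rewrite -natrM ler1n.
Unshelve. all: by end_near. Qed.

(** Inverting [b^r <= 2 (r+1) tail_ratio] gives the bound [2 (r+1) (1/b)^r], where [1/b] has a limit
    below [1]. *)
Lemma tail_ratio_outside : 1 < szego_fun zeta ->
  (tail_ratio (r j) (n j) (z j))^-1 @[j --> \oo] --> (0 : R).
Proof.
move=> g1.
have g0 : szego_fun zeta != 0 by rewrite gt_eqF //; lra.
have bV : (b j)^-1 @[j --> \oo] --> (szego_fun zeta)^-1 by apply: cvgV.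
have bV0 j : 0 <= (b j)^-1 by rewrite invr_ge0.
have gV1 : (szego_fun zeta)^-1 < 1 by rewrite invf_lt1 //; lra.
have P := cvg_linear_geometric roo bV0 bV gV1.
apply: (squeeze_cvgr _ (cvg_cst 0) P).
have H : \forall j \near \oo, scaled_step (r j) (n j) < 1 by apply: (cvgr_lt _ s0).
have H' : \forall j \near \oo, 1 < b j by apply: (cvgr_gt _ bl).
near=> j; have sj : scaled_step (r j) (n j) < 1 by near: j.
have bj : 1 < b j by near: j.
have b0 : 0 < b j by lra.
have /andP[_] := tail_ratio_bounds (rn j) sj (z1 j); rewrite -/(b j) => h2.
have k0 : 0 < 2 * (r j).+1%:R :> R by rewrite mulr_gt0 ?ltr0n.
have t0 : 0 < tail_ratio (r j) (n j) (z j).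
  by rewrite -(pmulr_rgt0 _ k0); apply: lt_le_trans h2; rewrite exprn_gt0.
rewrite invr_ge0 (ltW t0) /= exprVn -ler_pdivrMl //.
by rewrite -invfM lef_pV2 ?posrE ?exprn_gt0 ?(mulr_gt0 k0 t0).
Unshelve. all: by end_near. Qed.
End Sequence.
End Asymptotics.

(** * Limits of zeros lie on the curve *)

Section Szego.
Variable R : realType.
Local Notation nc := (@ComplexField.Normc.normc R).

Lemma scaled_coef_complex r n k :
  scaled_coef R[i] r n k = (scaled_coef R r n k)%:C.
Proof.
by rewrite /scaled_coef rmorphM rmorphXn rmorphM fmorphV rmorphB !rmorph_nat.
Qed.

Lemma scaled_step_complex r n :
  r%:R / (n%:R - r%:R) = (scaled_step R r n)%:C :> R[i].
Proof. by rewrite /scaled_step rmorphM fmorphV rmorphB !rmorph_nat. Qed.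

(** With [x = r/n], the step is [x/(1 - x)]. *)
Lemma scaled_step_cvg0 (r n : nat -> nat) :
  (forall j, (0 < r j < n j)%N) ->
  ((r j)%:R / (n j)%:R : R) @[j --> \oo] --> (0 : R) ->
  scaled_step R (r j) (n j) @[j --> \oo] --> (0 : R).
Proof.
move=> rn x0.
have c1 : (fun _ : nat => 1 : R) @ \oo --> (1 : R) by apply: cvg_cst.
have V : (1 - (r j)%:R / (n j)%:R)^-1 @[j --> \oo] --> (1 - 0 : R)^-1.
  by apply: cvgV; [rewrite subr0 oner_eq0 | exact: cvgB c1 x0].
have L : (r j)%:R / (n j)%:R * (1 - (r j)%:R / (n j)%:R)^-1 @[j --> \oo]
    --> (0 * (1 - 0)^-1 : R) by exact: cvgM x0 V.
rewrite mul0r in L; apply: cvg_trans L; apply: near_eq_cvg.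
apply: nearW => j; have /andP[r0 rnj] := rn j.
have n0 : (n j)%:R != 0 :> R by rewrite pnatr_eq0 -lt0n (ltn_trans r0).
have d0 : (n j)%:R - (r j)%:R != 0 :> R by rewrite subr_eq0 eqr_nat gtn_eqF.
rewrite /scaled_step /=; move: n0 d0; move: (r j)%:R (n j)%:R => a b b0 d0.
by field; rewrite b0 d0.
Qed.

Lemma cvg_sqrtV (r : nat -> nat) : (forall j, (0 < r j)%N) -> r @ \oo --> \oo ->
  (Num.sqrt (r j)%:R)^-1 @[j --> \oo] --> (0 : R).
Proof.
move=> r0 roo.
have P : \forall j \near \oo, 0 < (r j)%:R :> R by apply: nearW => j; rewrite ltr0n.
have ry : (r j)%:R @[j --> \oo] --> (+oo : set_system R) by apply/cvgrnyP.
have V := (gtr0_cvgV0 P).2 ry.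
have L : Num.sqrt ((r j)%:R^-1) @[j --> \oo] --> (Num.sqrt 0 : R).
  by apply: continuous_cvg; [exact: sqrt_continuous | exact: V].
rewrite sqrtr0 in L; apply: cvg_trans L; apply: near_eq_cvg; apply: nearW => j /=.
by rewrite sqrtrV ?ler0n.
Qed.

Section Sequence.
Variables (r n : nat -> nat) (z : nat -> R[i]) (zeta : R[i]).
Hypotheses (rn : forall j, (0 < r j < n j)%N) (roo : r @ \oo --> \oo).
Hypothesis s0 : scaled_step R (r j) (n j) @[j --> \oo] --> (0 : R).
Hypotheses (z1 : forall j, nc (z j) <= 1) (zz : converges (K := R[i]) z zeta).

Lemma scaled_tail_cvg : zeta != 1 ->
  converges (K := R[i]) (fun j => (scaled_tail R[i] (r j) (n j)).[z j])
    (zeta / (1 - zeta)).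
Proof.
move=> zeta1.
pose e j := (1 - z j) * ((1 - z j) * (scaled_tail R[i] (r j) (n j)).[z j] - z j).
apply: (tail_limit (e := e) zeta1 _ zz); last exact: nearW.
apply: converges_normc0.
have c1 (c : R) : (fun _ : nat => c) @ \oo --> c by apply: cvg_cst.
have r0 j : (0 < r j)%N by case/andP: (rn j).
(* With [w = sqrt r >= 1] and [u = 1/w] one has [T.[1] <= 2w], and [2 (1 + 2w) <= 6w]; dividing by
   [r = w^2] gives the bound [6 (1+s)/w]. *)
have U : 6 * (1 + scaled_step R (r j) (n j)) * (Num.sqrt (r j)%:R)^-1
     @[j --> \oo] --> (6 * (1 + 0) * 0 : R).
  exact: cvgM (cvgM (c1 6) (cvgD (c1 1) s0)) (cvg_sqrtV r0 roo).
rewrite mulr0 in U; apply: (squeeze_cvgr _ (cvg_cst 0) U).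
apply: nearW => j; rewrite normc_ge0 /=.
have /andP[rj0 rnj] := rn j.
set w : R := Num.sqrt (r j)%:R.
have rj1 : 1 <= (r j)%:R :> R by rewrite ler1n.
have w1 : 1 <= w by rewrite -[1]sqrtr1 ler_wsqrtr.
have w2 : w ^+ 2 = (r j)%:R by rewrite sqr_sqrtr ?ler0n.
have w0 : 0 < w by lra.
have u01 : 0 < (w^-1)%:C <= (1 : R)%:C.
  by rewrite ltcR lecR invr_gt0 w0 invf_le1.
have T1 := horner_tail1_le rj0 rnj u01.
have z1C : `|z j| <= 1 by rewrite normcE_real -[1]/((1 : R)%:C) lecR.
have := tail_estimate rj0 rnj z1C; rewrite -/(e j) normcE_real scaled_step_complex => H.
have s_ge0 : 0 <= scaled_step R (r j) (n j).
  by rewrite divr_ge0 // subr_ge0 ler_nat ltnW.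
have {}H : ((r j)%:R * nc (e j))%:C
   <= ((1 + scaled_step R (r j) (n j)) * (2 * (1 + 2 * w)))%:C.
  rewrite rmorphM rmorph_nat; apply: (le_trans H).
  rewrite [leRHS]rmorphM rmorphD rmorph1 ler_wpM2l //.
    by rewrite -[1]/((1 : R)%:C) -rmorphD -[0]/((0 : R)%:C) lecR addr_ge0.
  rewrite rmorphM rmorph_nat ler_wpM2l ?ler0n // rmorphD rmorph1 lerD2l.
  apply: (le_trans T1); rewrite -fmorphV invrK.
  have -> : (r j)%:R = (w ^+ 2)%:C :> R[i] by rewrite w2 rmorph_nat.
  rewrite -rmorphM -rmorphD lecR expr2 mulrA mulVf ?gt_eqF // mul1r.
  by rewrite mulr_natl mulr2n.
move: H; rewrite lecR -w2 => H.
rewrite ler_pdivlMr // -(ler_pM2r w0).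
have -> : nc (e j) * w * w = w ^+ 2 * nc (e j) by ring.
apply: (le_trans H); rewrite -subr_ge0.
move: (scaled_step R (r j) (n j)) s_ge0 => s s_ge0.
have -> : 6 * (1 + s) * w - (1 + s) * (2 * (1 + 2 * w)) = 2 * (w - 1) * (1 + s) by ring.
by apply: mulr_ge0; [rewrite mulr_ge0 // subr_ge0 | exact: addr_ge0].
Qed.

Lemma normc_scaled_section_root r' n' w : (0 < r' < n')%N ->
  scaled_step R r' n' < 1 -> root (scaled_section R[i] r' n') w ->
  tail_ratio r' n' w * nc (scaled_tail R[i] r' n').[w] = 1.
Proof.
move=> /andP[r0 rn'] s1 pw.
have w1 : nc w <= 1.
  have := scaled_section_root_le1 r0 rn' pw.
  by rewrite normcE_real -[1]/((1 : R)%:C) lecR.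
have s_ge0 : 0 <= scaled_step R r' n'.
  by rewrite divr_ge0 // subr_ge0 ler_nat ltnW.
have N0 : 0 < nc (1 + (scaled_step R r' n')%:C * w).
  by apply: lt_le_trans (normc_1D_ge s_ge0 w1); rewrite subr_gt0.
move/rootP: pw; rewrite horner_scaled_section // scaled_step_complex => /eqP.
rewrite subr_eq0 => /eqP/(congr1 nc); rewrite scaled_coef_complex /tail_ratio.
have := scaled_coef_ge0 R r0 rn' r'; move: (scaled_coef R _ _ _) => c c0.
rewrite !ComplexField.Normc.normcM !normcX normc_real // => e.
by rewrite mulrAC -e divff // expf_eq0 gt_eqF // andbF.
Qed.

(** At the zeros [tail_ratio * |T| = 1], with [|T|] tending to [t]. If [g > 1], then
    [|T| = 1/tail_ratio] would tend to [0], but [t > 0]; if [g < 1], the product would tend to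
    [0]. *)
Lemma roots_limit_szego :
  (forall j, root (scaled_section R[i] (r j) (n j)) (z j)) -> szego_fun zeta = 1.
Proof.
move=> pz.
have [z_eq1|zeta1] := eqVneq zeta 1.
  by rewrite z_eq1 /szego_fun ComplexField.Normc.normc1 mul1r subrr expR0.
have Tl := converges_normc (scaled_tail_cvg zeta1).
have H : \forall j \near \oo, scaled_step R (r j) (n j) < 1 by apply: (cvgr_lt _ s0).
set t := nc (zeta / (1 - zeta)) in Tl.
apply/eqP; rewrite eq_le; apply/andP; split; rewrite leNgt; apply/negP => g.
  have XV := tail_ratio_outside rn roo s0 z1 zz g.
  have t0 : 0 < t.
    rewrite lt_def normc_ge0 normc_eq0 mulf_neq0 //.
      apply: contraTneq g => ->; rewrite /szego_fun ComplexField.Normc.normc0 mul0r.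
      by rewrite lt_gtF.
    by rewrite invr_eq0 subr_eq0 eq_sym.
  have t2 : t / 2 < t by lra.
  have t20 : 0 < t / 2 by lra.
  have H1 : \forall j \near \oo, t / 2 < nc (scaled_tail R[i] (r j) (n j)).[z j].
    by apply: (cvgr_gt _ Tl).
  have H2 : \forall j \near \oo, (tail_ratio (r j) (n j) (z j))^-1 < t / 2.
    by apply: (cvgr_lt _ XV).
  have [j [[h h1] h2]] := filter_ex (filterI (filterI H H1) H2).
  have := normc_scaled_section_root (rn j) h (pz j).
  move=> e; have x0 : tail_ratio (r j) (n j) (z j) != 0.
    by apply/eqP => x0; move: e; rewrite x0 mul0r => /esym/eqP; rewrite oner_eq0.
  have {}e : (tail_ratio (r j) (n j) (z j))^-1 = nc (scaled_tail R[i] (r j) (n j)).[z j].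
    by apply: (mulfI x0); rewrite e divff.
  by move: h1; rewrite -e lt_gtF.
have X0 := tail_ratio_inside rn roo s0 z1 zz g.
have L : tail_ratio (r j) (n j) (z j) * nc (scaled_tail R[i] (r j) (n j)).[z j]
   @[j --> \oo] --> (0 * t : R) by exact: cvgM.
rewrite mul0r in L.
have H1 : \forall j \near \oo,
    tail_ratio (r j) (n j) (z j) * nc (scaled_tail R[i] (r j) (n j)).[z j] < 1.
  by apply: (cvgr_lt _ L).
have [j [h]] := filter_ex (filterI H H1).
by rewrite /= normc_scaled_section_root // ltxx.
Qed.
End Sequence.
End Szego.

(** * Zeros accumulate at every curve point other than [1] *)

Section Existence.
Variable R : realType.
Local Notation nc := (@ComplexField.Normc.normc R).

Lemma Re_le_normc (w : R[i]) : complex.Re w <= nc w.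
Proof.
have := normc_ge_Re w; rewrite normcE_real lecR; exact: le_trans (ler_norm _).
Qed.

Lemma Re_realM (t : R) (w : R[i]) : complex.Re (t%:C * w) = t * complex.Re w.
Proof. by case: w => a b /=; rewrite mul0r subr0. Qed.

Lemma szego_fun_scale (t : R) (w : R[i]) : 0 <= t ->
  szego_fun (t%:C * w) = t * expR ((1 - t) * complex.Re w) * szego_fun w.
Proof.
move=> t0; rewrite /szego_fun ComplexField.Normc.normcM normc_real // Re_realM.
have -> : 1 - t * complex.Re w
   = (1 - t) * complex.Re w + (1 - complex.Re w) by ring.
by rewrite expRD; ring.
Qed.

(** With [x = Re w], [e^(-u x) >= 1 - u x > 1 - u], so [(1 - u) e^(u x) < 1]. *)
Lemma szego_fun_shrink (u : R) (w : R[i]) : 0 < u < 1 -> complex.Re w < 1 ->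
  szego_fun w = 1 -> szego_fun ((1 - u)%:C * w) < 1.
Proof.
move=> /andP[u0 u1] x1 g1; rewrite szego_fun_scale; last by lra.
rewrite g1 mulr1; have -> : 1 - (1 - u) = u by ring.
have := expR_ge1Dx (- (u * complex.Re w)).
have ux : u * complex.Re w < u by rewrite gtr_pMr.
rewrite expRN => h; rewrite -ltr_pdivlMr ?expR_gt0 // mul1r.
by apply: lt_le_trans h; lra.
Qed.

(** With [x = Re w], [(1 + u)(1 - u x) - 1 = u (1 - x - u x)], positive because
    [u x < u < 1 - x]. *)
Lemma szego_fun_grow (u : R) (w : R[i]) : 0 < u -> u < 1 - complex.Re w ->
  complex.Re w < 1 -> szego_fun w = 1 -> 1 < szego_fun ((1 + u)%:C * w).
Proof.
move=> u0 u1 x1 g1; rewrite szego_fun_scale; last by lra.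
rewrite g1 mulr1; have -> : (1 - (1 + u)) * complex.Re w = - (u * complex.Re w) by ring.
have u1p : 0 < 1 + u by lra.
apply: lt_le_trans (ler_wpM2l (ltW u1p) (expR_ge1Dx _)).
have ux : u * complex.Re w < u by rewrite gtr_pMr.
rewrite -subr_gt0.
have -> : (1 + u) * (1 + - (u * complex.Re w)) - 1
   = u * (1 - complex.Re w - u * complex.Re w) by ring.
by rewrite mulr_gt0 //; lra.
Qed.

Section Sequence.
Variables (r n : nat -> nat).
Hypotheses (rn : forall j, (0 < r j < n j)%N) (roo : r @ \oo --> \oo).
Hypothesis s0 : scaled_step R (r j) (n j) @[j --> \oo] --> (0 : R).

Let q (w : R[i]) j := ((r j)%:R)^-1 *
  ((scaled_section R[i] (r j) (n j))^`().[w] / (scaled_section R[i] (r j) (n j)).[w]).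

Let s_cvg0 : converges (K := R[i]) (fun j => (scaled_step R (r j) (n j))%:C) 0.
Proof. exact: converges_real s0. Qed.

Let s_lt1 : \forall j \near \oo, scaled_step R (r j) (n j) < 1.
Proof. by apply: (cvgr_lt _ s0). Qed.

Let ratioC (w : R[i]) j : R[i] :=
  scaled_coef R[i] (r j) (n j) (r j) * w ^+ r j
    / (1 + (scaled_step R (r j) (n j))%:C * w) ^+ n j.

Let normc_ratioC w j : nc (ratioC w j) = tail_ratio (r j) (n j) w.
Proof.
have /andP[r0 rn'] := rn j.
rewrite /ratioC scaled_coef_complex /tail_ratio.
have := scaled_coef_ge0 R r0 rn' (r j); move: (scaled_coef R _ _ _) => c c0.
by rewrite !ComplexField.Normc.normcM ComplexField.Normc.normcV !normcX normc_real.
Qed.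

Let step_neq0 w j : scaled_step R (r j) (n j) < 1 -> nc w <= 1 ->
  1 + (scaled_step R (r j) (n j))%:C * w != 0.
Proof.
move=> s1 w1; rewrite -normc_eq0 gt_eqF //.
have /andP[r0 rn'] := rn j.
have s_ge0 : 0 <= scaled_step R (r j) (n j).
  by rewrite divr_ge0 // subr_ge0 ler_nat ltnW.
by apply: lt_le_trans (normc_1D_ge s_ge0 w1); rewrite subr_gt0.
Qed.

Let q_ode w j : (scaled_section R[i] (r j) (n j)).[w] != 0 ->
  (1 + (scaled_step R (r j) (n j))%:C * w) * q w j
  = (1 + (scaled_step R (r j) (n j))%:C)
    - scaled_coef R[i] (r j) (n j) (r j) * w ^+ r j
      / (scaled_section R[i] (r j) (n j)).[w].
Proof.
move=> p0; have /andP[rj0 rnj] := rn j.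
have r0 : (r j)%:R != 0 :> R[i] by rewrite pnatr_eq0 -lt0n.
have := scaled_section_ode rnj w; rewrite scaled_step_complex /q.
move: p0 r0; move: (scaled_step R _ _)%:C (_.[w]) (_^`().[w]) ((r j)%:R).
move: (scaled_coef _ _ _ _) (w ^+ _) => a wr s p p' k p0 k0 e.
have -> : (1 + s * w) * (k^-1 * (p' / p)) = ((1 + s * w) * p') / (k * p).
  by field; rewrite k0 p0.
by rewrite e; field; rewrite k0 p0.
Qed.

Lemma logderiv_cvg_inside (w : R[i]) : nc w <= 1 -> szego_fun w < 1 ->
  converges (K := R[i]) (q w) 1.
Proof.
move=> w1 g; have wc : converges (K := R[i]) (fun=> w) w by apply: converges_cst.
have w_neq1 : w != 1.
  by apply: contraTneq g => ->; rewrite /szego_fun ComplexField.Normc.normc1 mul1r subrr expR0 ltxx.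
have T := scaled_tail_cvg rn roo s0 (fun=> w1) wc w_neq1.
have Y : converges (K := R[i]) (ratioC w) 0.
  apply: converges_normc0; under eq_fun do rewrite normc_ratioC.
  exact: (tail_ratio_inside rn roo s0 (fun=> w1) wc g).
apply: (logderiv_limit_inside s_cvg0 Y T _ wc).
(* [YT] says that [p] does not vanish at [w], as the factorisation [pE] shows; [q_ode] needs
   this. *)
near=> j => YT; have sj : scaled_step R (r j) (n j) < 1 by near: j.
have /andP[rj0 rnj] := rn j.
have d0 := step_neq0 sj w1.
have dn0 := expf_neq0 (n j) d0.
have pE : (scaled_section R[i] (r j) (n j)).[w]
   = (1 + (scaled_step R (r j) (n j))%:C * w) ^+ n j *
     (1 - ratioC w j * (scaled_tail R[i] (r j) (n j)).[w]).
  rewrite horner_scaled_section // scaled_step_complex mulrBr mulr1 mulrA /ratioC.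
  by rewrite [X in _ = _ - X * _]mulrC divfK.
rewrite q_ode; last by rewrite pE mulf_neq0.
by rewrite pE invfM mulrA.
Unshelve. all: by end_near. Qed.

Lemma logderiv_cvg_outside (w : R[i]) : nc w <= 1 -> 1 < szego_fun w ->
  converges (K := R[i]) (q w) w^-1.
Proof.
move=> w1 g; have wc : converges (K := R[i]) (fun=> w) w by apply: converges_cst.
have w_neq1 : w != 1.
  by apply: contraTneq g => ->; rewrite /szego_fun ComplexField.Normc.normc1 mul1r subrr expR0 ltxx.
have w_neq0 : w != 0.
  apply: contraTneq g => ->; rewrite /szego_fun ComplexField.Normc.normc0 mul0r.
  by rewrite lt_gtF.
have T := scaled_tail_cvg rn roo s0 (fun=> w1) wc w_neq1.
have W : converges (K := R[i]) (fun j => (ratioC w j)^-1) 0.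
  apply: converges_normc0.
  under eq_fun do rewrite ComplexField.Normc.normcV normc_ratioC.
  exact: (tail_ratio_outside rn roo s0 (fun=> w1) wc g).
apply: (logderiv_limit_outside w_neq0 w_neq1 s_cvg0 W T _ wc).
near=> j => WT; have sj : scaled_step R (r j) (n j) < 1 by near: j.
have /andP[rj0 rnj] := rn j.
have d0 := step_neq0 sj w1.
have dn0 := expf_neq0 (n j) d0.
have a0 : scaled_coef R[i] (r j) (n j) (r j) * w ^+ r j != 0.
  rewrite mulf_neq0 ?expf_neq0 // gt_eqF //.
  by apply: scaled_coef_gt0 => //; rewrite ltnW.
(* Outside the curve [a w^r] dominates, so it is factored out in place of [(1 + s w)^n]. *)
have pE : (scaled_section R[i] (r j) (n j)).[w]
   = (scaled_coef R[i] (r j) (n j) (r j) * w ^+ r j) *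
     ((ratioC w j)^-1 - (scaled_tail R[i] (r j) (n j)).[w]).
  rewrite horner_scaled_section // scaled_step_complex mulrBr /ratioC invf_div.
  by rewrite [X in _ = X - _]mulrC divfK.
rewrite q_ode; last by rewrite pE mulf_neq0.
by rewrite pE invfM mulVKf // div1r.
Unshelve. all: by end_near. Qed.

(** The bound by [rho] keeps the test points of [root_near] close to [zeta], the bound by [(1-m)/2]
    keeps them in the disc, and the last one puts the Lipschitz bound below the gap between the two
    limits. *)
Lemma scale_choice (m rho : R) : 0 <= m < 1 -> 0 < rho ->
  exists u : R, [/\ 0 < u, u <= rho, u <= (1 - m) / 2
    & 2 * u / rho ^+ 2 < (1 - m) / 2].
Proof.
move=> /andP[m0 m1] rho0; have r2 : 0 < rho ^+ 2 by rewrite exprn_gt0.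
exists (Num.min rho (Num.min ((1 - m) / 2) (rho ^+ 2 * (1 - m) / 8))).
have p1 : 0 < (1 - m) / 2 by lra.
have p2 : 0 < rho ^+ 2 * (1 - m) / 8.
  by rewrite divr_gt0 // mulr_gt0 // subr_gt0.
split.
- by rewrite !lt_min rho0 p1 p2.
- by rewrite ge_min lexx.
- by rewrite !ge_min lexx orbT.
rewrite ltr_pdivrMr //.
set u := Num.min _ _.
have : u <= rho ^+ 2 * (1 - m) / 8 by rewrite !ge_min lexx !orbT.
lra.
Qed.

Lemma root_near (zeta : R[i]) (delta : R) : 0 < delta -> zeta != 0 ->
  nc zeta < 1 -> szego_fun zeta = 1 ->
  \forall j \near \oo, exists w, root (scaled_section R[i] (r j) (n j)) w
    /\ nc (zeta - w) < delta.
Proof.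
move=> delta0 zeta0 m1 g1; set m := nc zeta in m1.
have m0 : 0 <= m by exact: normc_ge0.
pose rho := delta / 2; have rho0 : 0 < rho by rewrite /rho; lra.
have m01 : 0 <= m < 1 by rewrite m0.
have [u [u0 u1 u2 u3]] := scale_choice m01 rho0.
have xm : complex.Re zeta <= m by exact: Re_le_normc.
(* Two test points on the ray through [zeta], on either side of the curve: [q a] tends to [1] and
   [q b] to [1/b]. *)
pose a : R[i] := (1 - u)%:C * zeta; pose b : R[i] := (1 + u)%:C * zeta.
have na : nc a = (1 - u) * m.
  by rewrite ComplexField.Normc.normcM normc_real //; lra.
have nb : nc b = (1 + u) * m.
  by rewrite ComplexField.Normc.normcM normc_real //; lra.
have um0 : 0 <= u * m by rewrite mulr_ge0 // ltW.
have um : u * m <= u by rewrite ler_piMr // ltW.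
have a1 : nc a <= 1 by rewrite na; lra.
have b1 : nc b <= (1 + m) / 2 by rewrite nb; lra.
have b1' : nc b <= 1 by lra.
have qa : converges (K := R[i]) (q a) 1.
  apply: logderiv_cvg_inside => //; apply: szego_fun_shrink => //; last by lra.
  by apply/andP; split; lra.
have qb : converges (K := R[i]) (q b) b^-1.
  by apply: logderiv_cvg_outside => //; apply: szego_fun_grow => //; lra.
have b0 : b != 0.
  rewrite mulf_neq0 // -normc_eq0 normc_real; lra.
have nb0 : 0 < nc b by rewrite lt_def normc_eq0 b0 normc_ge0.
have nab : nc (a - b) = 2 * (u * m).
  have -> : a - b = - ((2 * u)%:C * zeta).
    rewrite /a /b -mulrBl -rmorphB -mulNr -rmorphN; congr (_ %:C * _); ring.
  by rewrite normcN ComplexField.Normc.normcM normc_real ?mulrA //; lra.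
(* [|1 - 1/b| = |b - 1|/|b|], where [|b - 1| >= 1 - |b| >= (1-m)/2] and [|b| <= 1]. *)
have D : 2 * u / rho ^+ 2 < nc (1 - b^-1).
  have -> : 1 - b^-1 = (b - 1) / b by rewrite mulrBl divff // mul1r.
  rewrite ComplexField.Normc.normcM ComplexField.Normc.normcV.
  apply: (lt_le_trans u3); rewrite ler_pdivlMr //.
  have h1 : 1 - nc b <= nc (b - 1).
    have := ler_normc_dist 1 b; rewrite ComplexField.Normc.normc1 normc_distB.
    by apply: le_trans; apply: ler_norm.
  apply: (le_trans _ h1); apply: (@le_trans _ _ ((1 - m) / 2)); last by lra.
  by rewrite ler_piMr //; lra.
have Dc : 0 <= (2 * u / rho ^+ 2)%:C < `|1 - b^-1|.
  rewrite normcE_real ltcR D andbT lecR divr_ge0 ?exprn_ge0 //; lra.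
have := converges_dist qa qb Dc; apply: filterS => j.
have /andP[rj0 rnj] := rn j.
(* With no root within [delta], the Lipschitz bound contradicts the eventual gap. *)
apply: contraPP => noroot; apply/negP; rewrite -real_leNgt ?normr_real //; last first.
  by rewrite complex_real.
have far w : root (scaled_section R[i] (r j) (n j)) w -> delta <= nc (zeta - w).
  by move=> pw; rewrite leNgt; apply/negP => wd; apply: noroot; exists w.
have tri c w : nc (zeta - w) <= nc (zeta - c) + nc (c - w).
  by have := le_normcD (zeta - c) (c - w); rewrite addrA subrK.
have za : nc (zeta - a) = u * m.
  have -> : zeta - a = u%:C * zeta.
    by rewrite /a rmorphB rmorph1; ring.
  by rewrite ComplexField.Normc.normcM normc_real // ltW.
have zb : nc (zeta - b) = u * m.
  have -> : zeta - b = - (u%:C * zeta).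
    by rewrite /b rmorphD rmorph1; ring.
  by rewrite normcN ComplexField.Normc.normcM normc_real // ltW.
(* Both test points are within [u m <= rho = delta/2] of [zeta], so roots stay at least [rho] away
   from them. *)
have sep w : root (scaled_section R[i] (r j) (n j)) w ->
    rho%:C <= `|a - w| /\ rho%:C <= `|b - w|.
  move=> pw; have := far w pw; have := tri a w; have := tri b w.
  by rewrite za zb !normcE_real !lecR /rho; move: u1; rewrite /rho => *; split; lra.
have p0 : scaled_section R[i] (r j) (n j) != 0.
  apply: contraTneq isT => p0; have := far zeta.
  rewrite p0 root0 subrr ComplexField.Normc.normc0 => /(_ isT).
  by rewrite leNgt delta0.
have sp : (size (scaled_section R[i] (r j) (n j)) <= (r j).+1)%N.
  by rewrite scaled_sectionE size_poly.
have rhoC : 0 < rho%:C by rewrite ltcR.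
have := logderiv_lipschitz rhoC p0 sp sep.
have r0 : 0 < (r j)%:R :> R[i] by rewrite ltr0n.
rewrite /q -mulrBr normrM normfV (ger0_norm (ltW r0)) => H.
rewrite ler_pdivrMl //; apply: (le_trans H); rewrite ler_wpM2l ?ler0n //.
rewrite normcE_real nab -rmorphXn -fmorphV -rmorphM lecR.
by rewrite ler_pM2r ?invr_gt0 ?exprn_gt0 // ler_pM2l.
Qed.
End Sequence.
End Existence.

(** * The curve in real terms, its point [1], and selection of subsequences *)

Section Main.
Variable R : realType.
Local Notation nc := (@ComplexField.Normc.normc R).

Lemma normc_cexp (w : R[i]) : nc (cexp w) = expR (complex.Re w).
Proof.
case: w => x y /=; rewrite !exprMn -mulrDr cos2Dsin2 mulr1 sqrtr_sqr.
by rewrite ger0_norm // ltW // expR_gt0.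
Qed.

Lemma szego_curveE (w : R[i]) : szego_curve R w <-> szego_fun w = 1 /\ nc w <= 1.
Proof.
rewrite /szego_curve /=; have -> : `|w * cexp (1 - w)| = (szego_fun w)%:C.
  rewrite normcE_real ComplexField.Normc.normcM normc_cexp /szego_fun.
  by case: w.
rewrite normcE_real -[1]/((1 : R)%:C) lecR.
by split=> -[g h]; split=> //; [case: g | rewrite g].
Qed.

(** On the unit circle the equation becomes [e^(1 - Re w) = 1], which forces [Re w = 1] and then
    [Im w = 0]. *)
Lemma szego_fun_unit (w : R[i]) : nc w = 1 -> szego_fun w = 1 -> w = 1.
Proof.
move=> w1; rewrite /szego_fun w1 mul1r -[RHS]expR0 => /expR_inj e.
have x1 : complex.Re w = 1 by apply/esym/eqP; rewrite -subr_eq0 e.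
case: w w1 x1 {e} => x y /= w1 x1; rewrite x1 in w1 *.
have : (1 : R) ^+ 2 + y ^+ 2 = 1.
  by rewrite -[LHS]sqr_sqrtr ?addr_ge0 ?sqr_ge0 // w1 expr1n.
rewrite expr1n -[RHS]addr0 => /addrI/eqP; rewrite sqrf_eq0 => /eqP ->.
by [].
Qed.

(* For [0 <= x < 1] the curve meets the line [Re w = x] where [|w| = e^(x-1)]. *)
Lemma szego_curve_near1 (delta : R) : 0 < delta ->
  exists w : R[i], [/\ w != 0, nc w < 1, szego_fun w = 1 & nc (1 - w) < delta].
Proof.
move=> d0.
(* For the point with real part [1 - t], [|1 - w|^2 = e^(-2t) + 2t - 1 <= 2t]. *)
have [t [t0 t1 td]] : exists t : R, [/\ 0 < t, t < 1 & 2 * t < delta ^+ 2].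
  have p : 0 < delta ^+ 2 by rewrite exprn_gt0.
  exists (Num.min (1 / 2) (delta ^+ 2 / 4)); split.
  - by rewrite lt_min; apply/andP; split; lra.
  - by rewrite gt_min; apply/orP; left; lra.
  - set v := Num.min _ _.
    have : v <= delta ^+ 2 / 4 by rewrite ge_min lexx orbT.
    lra.
have E0 : 0 < expR (- t) by exact: expR_gt0.
have E1 : expR (- t) < 1 by rewrite -expR0 ltr_expR; lra.
have Ex : (1 - t) ^+ 2 <= expR (- t) ^+ 2.
  rewrite lerXn2r ?nnegrE ?(ltW E0) //; first by lra.
  by have := expR_ge1Dx (- t).
pose w : R[i] := Complex (1 - t) (Num.sqrt (expR (- t) ^+ 2 - (1 - t) ^+ 2)).
have nw : nc w = expR (- t).
  rewrite /= sqr_sqrtr ?subr_ge0 // addrC subrK sqrtr_sqr ger0_norm //.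
exists w; split.
- by rewrite -normc_eq0 nw gt_eqF.
- by rewrite nw.
- rewrite /szego_fun nw -expRD.
  have -> : - t + (1 - complex.Re w) = 0 by rewrite /=; ring.
  exact: expR0.
- rewrite -(@ltr_pXn2r _ 2) ?nnegrE ?normc_ge0 ?(ltW d0) //.
  apply: le_lt_trans td.
  rewrite /= sub0r sqrrN sqr_sqrtr ?addr_ge0 ?sqr_ge0 //.
  rewrite sqr_sqrtr ?subr_ge0 //.
  have : expR (- t) ^+ 2 <= 1 by rewrite exprn_ile1 ?ltW.
  rewrite (_ : (1 - (1 - t)) ^+ 2 + _ = expR (- t) ^+ 2 + 2 * t - 1); last by ring.
  lra.
Qed.

Lemma increasing_selection (P : nat -> nat -> Prop) :
  (forall i, \forall j \near \oo, P i j) ->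
  exists j : nat -> nat, {homo j : a b / (a < b)%N} /\ forall i, P i (j i).
Proof.
move=> H.
have /choice[N HN] : forall i, exists N, forall j, (N <= j)%N -> P i j.
  by move=> i; have [N _ HN] := H i; exists N => j Nj; exact: HN.
(* Taking the maximum with [(J i').+1] makes [J] increase; taking it with [N i] keeps [J] past the
   threshold for [P i]. *)
pose J := fix J i := if i is i'.+1 then maxn (J i').+1 (N i) else N 0%N.
exists J; split.
  by apply: homo_ltn => [? ? ?|i]; [exact: ltn_trans | rewrite /= leq_maxl].
by case=> [|i]; apply: HN => //=; exact: leq_maxr.
Qed.

Lemma homo_ltn_cvg_oo (j : nat -> nat) : {homo j : a b / (a < b)%N} ->
  j @ \oo --> \oo.
Proof.
move=> jh; apply/cvgnyPge => A.
have ge i : (i <= j i)%N.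
  by elim: i => // i IH; apply: leq_ltn_trans IH _; apply: jh.
near=> i; apply: leq_trans (ge i); near: i; exact: nbhs_infty_ge.
Unshelve. all: by end_near. Qed.

End Main.

(** * The two inclusions *)

Theorem theorem2p4 (R : realType) (r n : nat -> nat)
    (hrn : forall j, (1 <= r j)%N /\ (r j < n j - 1)%N)
    (hr : r @ \oo --> \oo)
    (hrn0 : ((r j)%:R / (n j)%:R : R) @[j --> \oo] --> (0 : R)) :
  [set zeta : R[i] | zeros_limit_point
     (fun j => binomial_section (R[i]) (r j) (n j) \Po
               (((r j)%:R / ((n j)%:R - (r j)%:R)) *: 'X)) zeta]
  = szego_curve R.
Proof.
have rn j : (0 < r j < n j)%N.
  have [r0 rn] := hrn j; rewrite r0 /=.
  by apply: leq_trans rn _; rewrite leq_subr.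
have s0 := scaled_step_cvg0 rn hrn0.
apply/seteqP; split=> [zeta [j [z [jh pz zz]]]|zeta].
  (* The hypotheses pass to the subsequence selected by [j], to which [roots_limit_szego] is
     applied. *)
  have joo := homo_ltn_cvg_oo jh.
  have rnj i : (0 < r (j i) < n (j i))%N by exact: rn.
  have rjoo : (r \o j) @ \oo --> \oo by exact: cvg_comp joo hr.
  have sj0 : scaled_step R (r (j i)) (n (j i)) @[i --> \oo] --> (0 : R).
    exact: (cvg_comp j (fun k => scaled_step R (r k) (n k)) joo s0).
  have z1 i : ComplexField.Normc.normc (z i) <= 1.
    have /andP[r0 rn'] := rnj i.
    have := scaled_section_root_le1 r0 rn' (pz i).
    by rewrite normcE_real -[1]/((1 : R)%:C) lecR.
  apply/szego_curveE; split; first exact: (roots_limit_szego rnj rjoo sj0 z1 zz pz).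
  apply: (cvgr_to_le (converges_normc zz)); exact: nearW.
move=> /szego_curveE[g h].
have near_root (delta : R) : 0 < delta -> \forall j \near \oo,
    exists w, root (scaled_section R[i] (r j) (n j)) w
      /\ ComplexField.Normc.normc (zeta - w) < delta.
  (* At [zeta = 1], where [root_near] does not apply, a curve point [w] within [delta/2] is used,
     and then a zero within [delta/2] of [w]. *)
  move=> d0; have [zeta1|zeta1] := eqVneq zeta 1.
    have d2 : 0 < delta / 2 by lra.
    have [w [w0 w1 gw wd]] := szego_curve_near1 d2.
    have := root_near rn hr s0 d2 w0 w1 gw; apply: filterS => j [v [pv wv]].
    exists v; split=> //; rewrite zeta1.
    have := le_normcD (1 - w) (w - v); rewrite addrA subrK => /le_lt_trans; apply.
    lra.
  apply: root_near => //.
    apply: contra_eqT g => /negPn/eqP ->.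
    by rewrite /szego_fun ComplexField.Normc.normc0 mul0r eq_sym oner_eq0.
  rewrite lt_neqAle h andbT; apply: contraNN zeta1 => /eqP z1.
  by apply/eqP; apply: szego_fun_unit.
have inv_gt0 i : 0 < i.+1%:R^-1 :> R by rewrite invr_gt0 ltr0n.
(* The radii [1/(i+1)] make the chosen zeros converge to [zeta] by comparison with the harmonic
   sequence. *)
have [j [jh Hj]] := increasing_selection (fun i => near_root _ (inv_gt0 i)).
have /choice[z Hz] := Hj.
exists j, z; split=> //; first by move=> i; have [] := Hz i.
apply/convergesP.
apply: (squeeze_cvgr _ (cvg_cst 0) (@cvg_harmonic R)).
apply: nearW => i; rewrite normc_ge0 /= normc_distB ltW //.
by have [] := Hz i.
Qed.
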